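(* For any integer $\ell\geq 4$ there exists a graph $G$ with an edge $e$ such that $\gamma_g'(G)=\ell$ and $\gamma_g'(G-e)=\ell-1$.
   Context: Graphs are finite, simple and undirected. A vertex dominates itself and all its neighbors. The domination game on a graph $G$ is played by two players, Dominator and Staller, who alternately choose a vertex of $G$ such that each chosen vertex dominates at least one vertex that was not dominated by the previously chosen vertices. The game ends when all vertices of $G$ are dominated. Dominator wants the total number of chosen vertices to be as small as possible, Staller wants it to be as large as possible. Assuming both play optimally, $\gamma_g'(G)$ (the Staller-start game domination number) is the total number of vertices chosen when Staller moves first. $G-e$ denotes the graph obtained from $G$ by removing the edge $e$ (keeping all vertices). *)

(* Defs.v *)
From HB Require Import structures.
From mathcomp Require Import all_boot.

Set Implicit Arguments.
Unset Strict Implicit.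
Unset Printing Implicit Defensive.

Record sgraph := SGraph {
  vertex :> finType;
  adj : rel vertex;
  adj_sym : symmetric adj;
  adj_irrefl : irreflexive adj }.

Section EdgeRemoval.
Variables (G : sgraph) (x y : G).

Definition del_edge_rel : rel G :=
  fun a b => adj a b && ([set a; b] != [set x; y]).

Lemma del_edge_sym : symmetric del_edge_rel.
Proof. by move=> a b; rewrite /del_edge_rel adj_sym setUC. Qed.

Lemma del_edge_irrefl : irreflexive del_edge_rel.
Proof. by move=> a; rewrite /del_edge_rel adj_irrefl. Qed.

Definition del_edge : sgraph := SGraph del_edge_sym del_edge_irrefl.
End EdgeRemoval.

Variant player := Dominator | Staller.

Section DominationGame.
Variable G : sgraph.
Implicit Types (S : {set G}) (v : G) (p : player).

Definition cl_nbh v : {set G} := [set u | (u == v) || adj v u].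

Definition dominated S : {set G} := \bigcup_(v in S) cl_nbh v.

Definition legal S v : bool := ~~ (cl_nbh v \subset dominated S).

(* Backward induction with fuel [n]. The value with fuel [m] never exceeds
   [m], so the default [m] of the minimum has no effect as soon as some move
   is legal. *)
Fixpoint moves_rec (n : nat) p S : nat :=
  if n is m.+1 then
    if dominated S == setT then 0
    else match p with
    | Dominator =>
        (\big[minn/m]_(v | legal S v) moves_rec m Staller (v |: S)).+1
    | Staller =>
        (\max_(v | legal S v) moves_rec m Dominator (v |: S)).+1
    end
  else 0.

(* Number of moves still to be made under optimal play, when the vertices of
   [S] have been chosen and [p] is to move. Each move dominates a new vertex,
   so the fuel suffices: see [moves0], [moves_Staller] and
   [moves_Dominator_le], [moves_Dominator_ex], which determine [moves]. *)
Definition moves p S : nat := moves_rec #|~: dominated S| p S.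

Lemma moves_rec_le n p S : moves_rec n p S <= n.
Proof.
elim: n p S => [|m IH] p S //=; case: ifP => // _; case: p; rewrite ltnS.
- by elim/big_rec: _ => // v k _ le_k; rewrite geq_min le_k orbT.
- by apply/bigmax_leqP => v _; apply: IH.
Qed.

Lemma legal_exists S : dominated S != setT -> exists v, legal S v.
Proof.
rewrite -subTset => /subsetPn[u _ uS]; exists u.
by apply/subsetPn; exists u; rewrite // inE eqxx.
Qed.

Lemma dominatedU1 v S : dominated (v |: S) = cl_nbh v :|: dominated S.
Proof. by rewrite /dominated bigcup_setU big_set1. Qed.

Lemma legal_card S v :
  legal S v -> #|~: dominated (v |: S)| < #|~: dominated S|.
Proof.
case/subsetPn=> u uv uS; apply/proper_card/properP; split.
- by rewrite setCS dominatedU1 subsetUr.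
- by exists u; rewrite !inE ?uS // dominatedU1 inE uv.
Qed.

Lemma bigminn_le (P : pred G) (F : G -> nat) m v :
  P v -> \big[minn/m]_(w | P w) F w <= F v.
Proof.
rewrite -big_filter => Pv.
have : v \in [seq w <- index_enum G | P w] by rewrite mem_filter Pv mem_index_enum.
elim: [seq w <- _ | _] => // w r IH; rewrite inE big_cons geq_min.
by case/predU1P=> [<-|/IH ->]; rewrite ?leqnn ?orbT.
Qed.

Lemma leq_bigminn (P : pred G) (F : G -> nat) c m :
  reflect (c <= m /\ forall v, P v -> c <= F v)
          (c <= \big[minn/m]_(v | P v) F v).
Proof.
apply: (iffP idP) => [le_c | [cm cF]].
- split=> [|v Pv]; apply: leq_trans le_c _.
  + by elim/big_rec: _ => // v k _ km; rewrite geq_min km orbT.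
  + exact: bigminn_le.
- by elim/big_rec: _ => // v k Pv ck; rewrite leq_min cF.
Qed.

Lemma bigminn_idx (P : pred G) (F : G -> nat) v m n :
  P v -> F v <= n ->
  \big[minn/m]_(w | P w) F w <= \big[minn/n]_(w | P w) F w.
Proof.
move=> Pv Fn; have /leq_bigminn[_ le_F] := leqnn (\big[minn/m]_(w | P w) F w).
by apply/leq_bigminn; split=> //; apply: leq_trans (le_F v Pv) Fn.
Qed.

Lemma card_undominated0 S :
  (#|~: dominated S| == 0) = (dominated S == setT).
Proof. by rewrite cards_eq0 -setCT (inj_eq (can_inj (@setCK _))). Qed.

Lemma moves_rec_fuel n k p S :
  #|~: dominated S| <= n -> #|~: dominated S| <= k ->
  moves_rec n p S = moves_rec k p S.
Proof.
elim: n k p S => [|n IH] [|k] p S //= le_n le_k.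
- by rewrite -card_undominated0 -leqn0 le_n.
- by rewrite -card_undominated0 -leqn0 le_k.
case: ifPn => // /legal_exists[v0 lv0].
have E q v : legal S v -> moves_rec n q (v |: S) = moves_rec k q (v |: S).
  by move=> /legal_card lt_v; apply: IH; rewrite -ltnS (leq_trans lt_v).
case: p; congr _.+1; last by apply: eq_bigr => v; apply: E.
rewrite (eq_bigr _ (E Staller)); apply/eqP; rewrite eqn_leq.
rewrite !(bigminn_idx (v := v0)) ?moves_rec_le //.
by rewrite -E ?moves_rec_le.
Qed.

Lemma moves0 p S : dominated S = setT -> moves p S = 0.
Proof. by move=> dS; rewrite /moves dS setCT cards0. Qed.

Lemma moves_fuel p S v m :
  legal S v -> #|~: dominated S| = m.+1 ->
  moves_rec m p (v |: S) = moves p (v |: S).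
Proof.
move=> /legal_card lt_v Em; apply: moves_rec_fuel => //.
by rewrite -ltnS -Em.
Qed.

Lemma undominatedS S :
  dominated S != setT -> #|~: dominated S| = #|~: dominated S|.-1.+1.
Proof.
by move=> dS; rewrite prednK // lt0n card_undominated0.
Qed.

Lemma moves_Staller S : dominated S != setT ->
  moves Staller S = (\max_(v | legal S v) moves Dominator (v |: S)).+1.
Proof.
move=> dS; have Em := undominatedS dS; rewrite {1}/moves Em /= (negPf dS).
by congr _.+1; apply: eq_bigr => v lv; apply: moves_fuel.
Qed.

Lemma moves_Dominator_le S v :
  legal S v -> moves Dominator S <= (moves Staller (v |: S)).+1.
Proof.
move=> lv; have dS : dominated S != setT.
  by apply: contraNneq lv => ->; apply: subsetT.
have Em := undominatedS dS; rewrite {1}/moves Em /= (negPf dS) ltnS.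
by rewrite -(moves_fuel _ lv Em) bigminn_le.
Qed.

Lemma moves_Dominator_ex S : dominated S != setT ->
  exists2 v, legal S v & moves Dominator S = (moves Staller (v |: S)).+1.
Proof.
move=> dS; have [v0 lv0] := legal_exists dS; have Em := undominatedS dS.
have [v lv min_v] := arg_minnP (fun v => moves Staller (v |: S)) lv0.
exists v => //; apply/eqP; rewrite eqn_leq moves_Dominator_le //=.
rewrite {2}/moves Em /= (negPf dS) ltnS; apply/leq_bigminn.
rewrite -(moves_fuel _ lv Em); split=> [|w lw]; first exact: moves_rec_le.
by rewrite !(moves_fuel _ _ Em) // min_v.
Qed.

End DominationGame.

Definition gamma_g' (G : sgraph) : nat := moves (G := G) Staller set0.

(* Main.v *)
(** Isolated vertices act as passes that cost one move each. If, from every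
    position of [G], Dominator moving first needs at most as many moves as
    Staller moving first, then nobody profits from passing, so adding [k]
    isolated vertices increases the game length by exactly [k]. It remains to
    find one graph settling [l = 4], such that both the graph and the graph with
    the edge removed have this property: the path 5-0-1-2-3 with a leaf 4
    attached to its middle vertex 1, and its edge 01. *)
Require Import Defs.
From mathcomp Require Import all_boot.

Set Implicit Arguments.
Unset Strict Implicit.
Unset Printing Implicit Defensive.

(** * Attaining and bounding the value of a position *)

Definition other p := if p is Dominator then Staller else Dominator.

Section Moves.
Variable G : sgraph.
Implicit Types (S : {set G}) (v : G) (p : player).

Lemma moves_Staller_ge S v :
  legal S v -> (moves Dominator (v |: S)).+1 <= moves Staller S.
Proof.
move=> lv; have dS : dominated S != setT.
  by apply: contraNneq lv => ->; apply: subsetT.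
by rewrite moves_Staller // ltnS (bigmax_sup v).
Qed.

Lemma moves_ex p S : dominated S != setT ->
  exists2 v, legal S v & moves p S = (moves (other p) (v |: S)).+1.
Proof.
case: p => dS; first exact: moves_Dominator_ex.
have [v0 lv0] := legal_exists dS.
have [v lv E] := eq_bigmax_cond (fun v => moves Dominator (v |: S))
  (introT card_gt0P (ex_intro _ v0 lv0)).
by exists v => //; rewrite moves_Staller // E.
Qed.

(** Treats both players at once: the move attaining [n] bounds the value on one side, an optimal
    move compared with [n] bounds it on the other, and [p] decides which side is which. *)
Lemma moves_eq p S n : dominated S != setT ->
  (exists2 v, legal S v & n = (moves (other p) (v |: S)).+1) ->
  (forall v, legal S v -> if p is Dominator
     then n <= (moves Staller (v |: S)).+1
     else (moves Dominator (v |: S)).+1 <= n) ->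
  moves p S = n.
Proof.
move=> dS [v lv En] opt; have [w lw Ew] := moves_ex p dS.
apply/eqP; rewrite eqn_leq; case: p opt En Ew => /= opt En Ew.
- by rewrite {1}En moves_Dominator_le // Ew opt.
- by rewrite Ew opt // -Ew En moves_Staller_ge.
Qed.

Lemma legalP S v :
  reflect (exists2 u, u \in cl_nbh v & u \notin dominated S) (legal S v).
Proof. exact: subsetPn. Qed.

Lemma dominatedP S v :
  reflect (exists2 u, u \in S & v \in cl_nbh u) (v \in dominated S).
Proof. exact: bigcupP. Qed.

End Moves.

(* The "no-minus" graphs of the literature, except that only positions reached
   by choosing vertices are considered. *)
Definition no_minus (G : sgraph) :=
  forall S : {set G}, moves Dominator S <= moves Staller S.

(** * Adding isolated vertices to a graph *)

Section IsolatedVertices.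
Variables (G H : sgraph) (h : G -> H).
Hypothesis h_inj : injective h.
Hypothesis h_adj : forall a b, adj (h a) (h b) = adj a b.
Hypothesis h_isolated : forall u v, u \notin codom h -> adj u v = false.
Implicit Types (S : {set H}) (u : H) (a : G).

(** The passes still available. *)
Definition spare S := [set u | (u \notin codom h) && (u \notin S)].

Lemma cl_nbh_emb a b : (h b \in cl_nbh (h a)) = (b \in cl_nbh a).
Proof. by rewrite !inE h_adj (inj_eq h_inj). Qed.

Lemma cl_nbh_isolated u : u \notin codom h -> cl_nbh u = [set u].
Proof. by move=> hu; apply/setP => v; rewrite !inE h_isolated ?orbF. Qed.

Lemma cl_nbh_sym u v : (u \in cl_nbh v) = (v \in cl_nbh u).
Proof. by rewrite !inE eq_sym adj_sym. Qed.

Lemma dominated_emb S a : (h a \in dominated S) = (a \in dominated (h @^-1: S)).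
Proof.
apply/dominatedP/dominatedP => [[u uS]|[b]]; last first.
  by rewrite inE => bS ab; exists (h b); rewrite // cl_nbh_emb.
have [/codomP[b Eu]|hu] := boolP (u \in codom h); last first.
  by rewrite cl_nbh_isolated // inE => /eqP Ea; rewrite -Ea codom_f in hu.
by rewrite Eu cl_nbh_emb => ab; exists b; rewrite // inE -Eu.
Qed.

Lemma dominated_isolated S u : u \notin codom h -> (u \in dominated S) = (u \in S).
Proof.
move=> hu; apply/dominatedP/idP => [[v vS]|uS].
  by rewrite cl_nbh_sym cl_nbh_isolated // inE => /eqP <-.
by exists u; rewrite // inE eqxx.
Qed.

Lemma legal_emb S a : legal S (h a) = legal (h @^-1: S) a.
Proof.
apply/legalP/legalP => [[u]|[b ab bS]]; last first.
  by exists (h b); rewrite ?cl_nbh_emb // dominated_emb.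
have [/codomP[b ->]|hu] := boolP (u \in codom h).
  by rewrite cl_nbh_emb dominated_emb; exists b.
by rewrite cl_nbh_sym cl_nbh_isolated // inE => /eqP Ea; rewrite -Ea codom_f in hu.
Qed.

Lemma legal_isolated S u : u \notin codom h -> legal S u = (u \notin S).
Proof.
by move=> hu; rewrite /legal cl_nbh_isolated // sub1set dominated_isolated.
Qed.

Lemma preim_emb S a : h @^-1: (h a |: S) = a |: h @^-1: S.
Proof. by apply/setP => b; rewrite !inE (inj_eq h_inj). Qed.

Lemma preim_isolated S u : u \notin codom h -> h @^-1: (u |: S) = h @^-1: S.
Proof.
move=> hu; apply/setP => b; rewrite !inE.
by case: eqP => // Eu; rewrite -Eu codom_f in hu.
Qed.

Lemma spare_emb S a : spare (h a |: S) = spare S.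
Proof.
apply/setP => u; rewrite !inE; case: eqP => //= ->.
by rewrite codom_f.
Qed.

Lemma card_spare_isolated S u : u \in spare S -> #|spare S| = #|spare (u |: S)|.+1.
Proof.
move=> uS; rewrite (cardsD1 u) uS add1n; congr _.+1; apply: eq_card => v.
by rewrite !inE; case: eqP => //= _; rewrite andbF.
Qed.

Lemma dominated_setT S : dominated (h @^-1: S) = setT -> spare S = set0 ->
  dominated S = setT.
Proof.
move=> dS fS; apply/setP => u; rewrite inE.
have [/codomP[a ->]|hu] := boolP (u \in codom h); first by rewrite dominated_emb dS inE.
have /setP/(_ u) := fS; rewrite !inE hu /= => /negbFE uS.
by rewrite dominated_isolated.
Qed.

(** A move in the image of [h] is a move in [G]. A move on a spare vertex costs one move and leaves
    the opponent to play in the same position of [G]; by [no_minus] this neither shortens the game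
    for Dominator nor lengthens it for Staller. *)
Lemma moves_isolated p S : no_minus G ->
  moves p S = moves p (h @^-1: S) + #|spare S|.
Proof.
move=> nmG; have [n] := ubnP #|~: dominated S|.
elim: n p S => // n IHn p S; rewrite ltnS => le_n.
have IH q v : legal S v ->
    moves q (v |: S) = moves q (h @^-1: (v |: S)) + #|spare (v |: S)|.
  by move=> /legal_card lv; apply: IHn; apply: leq_trans lv le_n.
have [dS|dS] := eqVneq (dominated S) setT.
  rewrite !moves0 //; last by apply/setP => a; rewrite -dominated_emb dS !inE.
  symmetry; apply/eqP; rewrite cards_eq0; apply/eqP/setP => u; rewrite !inE.
  by apply/negP => /andP[hu]; rewrite -dominated_isolated // dS inE.
apply: moves_eq => // [|v lv].
(* The value is attained by an optimal move of [G], or, once [G] is dominated, by a spare vertex,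
   which must exist as the game is not over. *)
- have [d0|/(moves_ex p)[a la ->]] := eqVneq (dominated (h @^-1: S)) setT.
    have /set0Pn[u uf] : spare S != set0.
      by apply: contraNneq dS => f0; rewrite dominated_setT.
    have /andP[hu uS] : (u \notin codom h) && (u \notin S) by rewrite inE in uf.
    exists u; first by rewrite legal_isolated.
    by rewrite IH ?legal_isolated // preim_isolated // (card_spare_isolated uf) !moves0.
  by exists (h a); rewrite ?legal_emb // IH ?legal_emb // preim_emb spare_emb addSn.
- have [/codomP[a Ev]|hv] := boolP (v \in codom h).
    rewrite Ev in lv *; rewrite !IH // preim_emb spare_emb -!addSn.
    rewrite legal_emb in lv.
    by case: (p); rewrite leq_add2r ?moves_Dominator_le ?moves_Staller_ge.
  have vf : v \in spare S by rewrite inE hv -legal_isolated.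
  rewrite !IH // preim_isolated // (card_spare_isolated vf) addnS.
  by case: (p); rewrite ltnS leq_add2r nmG.
Qed.

Lemma gamma_g'_isolated : no_minus G -> gamma_g' H = gamma_g' G + (#|H| - #|G|).
Proof.
move=> nmG; rewrite /gamma_g' moves_isolated // preimset0; congr (_ + _).
(* At the start every vertex outside the image of [h] is spare. *)
rewrite -(card_codom h_inj) -(cardC [in codom h]) addKn.
by apply: eq_card => u; rewrite !inE andbT.
Qed.

End IsolatedVertices.

(** * Evaluating the game by computation *)

(* Big operators and finite sets do not compute, hence this copy of [moves_rec];
   the bit list [d] records which of the vertices 0, ..., n - 1 are dominated. *)
Section Evaluation.
Variables (n : nat) (e : rel nat).

Definition covers i j := (j == i) || e i j.

Definition legal_bits (d : bitseq) i :=
  ~~ all (fun j => covers i j ==> nth false d j) (iota 0 n).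

Definition choose_bits (d : bitseq) i :=
  [seq covers i j || nth false d j | j <- iota 0 n].

Fixpoint eval_moves m p (d : bitseq) : nat :=
  if m is m'.+1 then
    if all (nth false d) (iota 0 n) then 0 else
    let r := [seq eval_moves m' (other p) (choose_bits d i)
             | i <- iota 0 n & legal_bits d i] in
    (if p is Dominator then foldr minn m' r else foldr maxn 0 r).+1
  else 0.

Variable r : rel 'I_n.
Hypotheses (r_sym : symmetric r) (r_irrefl : irreflexive r).
Hypothesis r_e : forall i j, r i j = e i j.
Let G := SGraph r_sym r_irrefl.

(** Missing entries read as [false], so [[::]] encodes the initial position. *)
Definition encodes (d : bitseq) (S : {set G}) :=
  forall i : 'I_n, nth false d i = (i \in dominated S).

Lemma all_iota_ord (P : pred nat) : all P (iota 0 n) = [forall i : 'I_n, P i].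
Proof.
apply/allP/forallP => [allP i|allP i]; first by apply: allP; rewrite mem_iota ltn_ord.
by rewrite mem_iota => lt_i; apply: (allP (Ordinal lt_i)).
Qed.

Lemma covers_nbh (i j : 'I_n) : covers i j = (j \in cl_nbh (i : G)).
Proof. by rewrite inE /= r_e. Qed.

Lemma legal_bitsE d S (i : 'I_n) : encodes d S -> legal_bits d i = legal S i.
Proof.
move=> dS; rewrite /legal_bits all_iota_ord /legal; congr (~~ _).
apply/forallP/subsetP => sub j; last by rewrite covers_nbh dS; apply/implyP/sub.
by move: (sub j); rewrite covers_nbh dS => /implyP.
Qed.

Lemma choose_bitsE d S (i : 'I_n) : encodes d S -> encodes (choose_bits d i) (i |: S).
Proof.
move=> dS j; rewrite (nth_map 0) ?size_iota // nth_iota //.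
by rewrite dominatedU1 inE add0n covers_nbh dS.
Qed.

Lemma moves_rec_eval m p d S : encodes d S -> moves_rec m p S = eval_moves m p d.
Proof.
elim: m p d S => //= m IH p d S dS; rewrite all_iota_ord.
have -> : (@dominated G S == setT) = [forall i : 'I_n, nth false d i].
  by rewrite -subTset; apply/subsetP/forallP => sub i; move: (sub i); rewrite dS => ->.
case: ifP => // _.
have eqF q (i : G) : @legal G S i ->
    @moves_rec G m q (i |: S) = eval_moves m q (choose_bits d (val i)).
  by move=> _; apply/IH/choose_bitsE.
(* Writing [n] as [n - 0] exposes [index_iota 0 n], so that the fold becomes a big operator over
   ['I_n]. *)
case: p; congr _.+1; rewrite (eq_bigr _ (eqF _));
  rewrite foldrE big_map big_filter -[n in iota 0 n]subn0 big_mkord;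
  by apply: eq_bigl => i; rewrite (legal_bitsE i dS).
Qed.

Lemma moves_eval p d S : encodes d S -> moves p S = eval_moves n p d.
Proof.
move=> dS; rewrite -(moves_rec_eval _ _ dS); apply: moves_rec_fuel => //.
by rewrite -[leqRHS](card_ord n) max_card.
Qed.

Lemma gamma_g'_eval : gamma_g' G = eval_moves n Staller [::].
Proof. by apply: moves_eval => i; rewrite nth_nil /dominated big_set0 inE. Qed.

Fixpoint bitseqs k : seq bitseq :=
  if k is k'.+1 then map (cons true) (bitseqs k') ++ map (cons false) (bitseqs k')
  else [:: [::]].

Lemma mem_bitseqs d : d \in bitseqs (size d).
Proof.
by elim: d => //= -[] d IH; rewrite mem_cat map_f ?orbT.
Qed.

(** Every position is encoded by a bit list of length [n], so it suffices to test all of these,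
    including lists that no position reaches. *)
Lemma no_minus_eval :
  all (fun d => eval_moves n Dominator d <= eval_moves n Staller d) (bitseqs n) ->
  no_minus G.
Proof.
move=> /allP le_eval S; pose d := [seq i \in dominated S | i : 'I_n].
have size_d : size d = n by rewrite size_map size_enum_ord.
have dS : encodes d S.
  by move=> i; rewrite (nth_map i) ?size_enum_ord // nth_ord_enum.
by rewrite !(moves_eval _ dS) le_eval // -[in bitseqs n]size_d mem_bitseqs.
Qed.

End Evaluation.

(** * Graphs given by edge lists, and edge deletion *)

Definition edges_adj (es : seq (nat * nat)) : rel nat :=
  fun i j => (i != j) && (((i, j) \in es) || ((j, i) \in es)).

Section EdgeList.
Variables (n : nat) (es : seq (nat * nat)).

Definition ord_adj : rel 'I_n := fun i j => edges_adj es i j.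

Lemma ord_adj_sym : symmetric ord_adj.
Proof. by move=> i j; rewrite /ord_adj /edges_adj eq_sym orbC. Qed.

Lemma ord_adj_irrefl : irreflexive ord_adj.
Proof. by move=> i; rewrite /ord_adj /edges_adj eqxx. Qed.

Definition edge_graph := SGraph ord_adj_sym ord_adj_irrefl.

End EdgeList.

(** Turns the set comparison in [del_edge_rel] into equalities of vertices, which injections
    preserve and which compute. *)
Lemma eq_set2 (T : finType) (a b x y : T) :
  ([set a; b] == [set x; y]) = (a == x) && (b == y) || (a == y) && (b == x).
Proof.
apply/eqP/idP => [/setP E|/orP[]/andP[/eqP-> /eqP->] //]; last exact: setUC.
move: (E a) (E b) (E x) (E y); rewrite !inE !eqxx !orbT /=.
rewrite ![x == _]eq_sym ![y == _]eq_sym.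
by case: (a == x) (b == y) (a == y) (b == x) => [] [] [] [].
Qed.

(** Lets the argument on isolated vertices apply after the deletion of an edge as well. *)
Lemma del_edge_emb (G H : sgraph) (h : G -> H) (x y a b : G) :
    injective h -> (forall a b, adj (h a) (h b) = adj a b) ->
  @adj (del_edge (h x) (h y)) (h a) (h b) = @adj (del_edge x y) a b.
Proof.
by move=> h_inj h_adj; rewrite /= /del_edge_rel h_adj !eq_set2 !(inj_eq h_inj).
Qed.

Section AddIsolated.
Variables (n k : nat) (es : seq (nat * nat)).
Hypothesis es_lt : all (fun ij => (ij.1 < n) && (ij.2 < n)) es.
Let G := edge_graph n es.
Let H := edge_graph (n + k) es.
Let h : G -> H := @lshift n k.

(** All endpoints in [es] are below [n], so a vertex with a neighbor in [H] comes from [G]. *)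
Lemma lshift_isolated (u v : H) : u \notin codom h -> @adj H u v = false.
Proof.
move=> hu; apply: contraNF hu => /andP[_ uv].
have lt_u : u < n by case/orP: uv => /(allP es_lt)/andP[].
by apply/codomP; exists (Ordinal lt_u); apply: val_inj.
Qed.

Lemma gamma_g'_add_isolated : no_minus G -> gamma_g' H = gamma_g' G + k.
Proof.
move=> nmG; rewrite (@gamma_g'_isolated G H h) // ?card_ord ?addKn //.
- exact: lshift_inj.
- exact: lshift_isolated.
Qed.

Lemma gamma_g'_del_edge_add_isolated (x y : G) : no_minus (del_edge x y) ->
  gamma_g' (del_edge (h x) (h y)) = gamma_g' (del_edge x y) + k.
Proof.
move=> nmG.
rewrite (@gamma_g'_isolated (del_edge x y) (del_edge (h x) (h y)) h) //.
- by rewrite !card_ord addKn.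
- exact: lshift_inj.
- by move=> a b; apply: del_edge_emb => //; apply: lshift_inj.
- by move=> u v hu; rewrite /= /del_edge_rel lshift_isolated.
Qed.

End AddIsolated.

(** * The tree on six vertices and the conclusion *)

Definition tree_edges := [:: (0, 1); (1, 2); (2, 3); (1, 4); (0, 5)].
Definition tree := edge_graph 6 tree_edges.

Definition v0 : tree := @Ordinal 6 0 isT.
Definition v1 : tree := @Ordinal 6 1 isT.

(** [behead] drops the pair [(0, 1)], which gives the deleted graph a computable adjacency. *)
Lemma del_tree_adj (i j : 'I_6) :
  @del_edge_rel tree v0 v1 i j = edges_adj (behead tree_edges) i j.
Proof.
rewrite /del_edge_rel eq_set2.
by case: i j => [[|[|[|[|[|[|i]]]]]] lt_i] [[|[|[|[|[|[|j]]]]]] lt_j].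
Qed.

Lemma tree_no_minus : no_minus tree.
Proof. by apply: no_minus_eval => [//|]; vm_compute. Qed.

Lemma gamma_g'_tree : gamma_g' tree = 4.
Proof. by rewrite (gamma_g'_eval _ _ (fun i j => erefl)); vm_compute. Qed.

Lemma del_tree_no_minus : no_minus (del_edge v0 v1).
Proof. by apply: (no_minus_eval del_tree_adj); vm_compute. Qed.

Lemma gamma_g'_del_tree : gamma_g' (del_edge v0 v1) = 3.
Proof. by rewrite (gamma_g'_eval (del_edge_sym v0 v1) (del_edge_irrefl v0 v1) del_tree_adj); vm_compute. Qed.

Theorem proposition2p6 (l : nat) (hl : 4 <= l) :
  exists (G : sgraph) (x y : G),
    [/\ adj x y, gamma_g' G = l & gamma_g' (del_edge x y) = l - 1].
Proof.
(* The tree accounts for 4 moves, so [l - 4] isolated vertices are added. *)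
exists (edge_graph (6 + (l - 4)) tree_edges), (lshift _ v0), (lshift _ v1); split=> //.
- rewrite gamma_g'_add_isolated //; last exact: tree_no_minus.
  by rewrite gamma_g'_tree subnKC.
- rewrite gamma_g'_del_edge_add_isolated //; last exact: del_tree_no_minus.
  (* With [l] written as [4 + (l - 4)], the right-hand side computes to [3 + (l - 4)]. *)
  by rewrite gamma_g'_del_tree -[in RHS](subnKC hl).
Qed.
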